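(* Let $H^2(\beta)$ be a weighted Hardy space of analytic functions on the open unit disk $\mathbb{D}$ such that $\sup_j \beta(j+1)/\beta(j)$ is finite. Let $\psi$ be analytic on $\mathbb{D}$ with $\psi\not\equiv0$, such that the multiplication operator $M_\psi f=\psi f$ is bounded on $H^2(\beta)$, and let $\varphi:\mathbb{D}\to\mathbb{D}$ be analytic and not constant. If $C_{\psi,\varphi}$ is cohyponormal on $H^2(\beta)$, then $\psi$ never vanishes on $\mathbb{D}$ and $\varphi$ is univalent.
   Context: A weighted Hardy space is a Hilbert space $H$ of analytic functions on $\mathbb{D}$ in which the monomials $1,z,z^2,\dots$ form an orthogonal set of non-zero vectors with dense span, normalized by $\|1\|=1$. Its weight sequence is $\beta(n)=\|z^n\|$, and the space is denoted $H^2(\beta)$; its inner product is $\langle\sum_j a_jz^j,\sum_j c_jz^j\rangle=\sum_j a_j\overline{c_j}\,\beta(j)^2$ (functions being identified with their Maclaurin series). The weighted composition operator is $C_{\psi,\varphi}f=\psi\cdot(f\circ\varphi)$. A bounded operator $A$ on a Hilbert space is hyponormal if $A^*A\ge AA^*$, and cohyponormal if $A^*$ is hyponormal; cohyponormality of $C_{\psi,\varphi}$ on $H^2(\beta)$ includes its boundedness there. Univalent means injective on $\mathbb{D}$. *)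

(* Defs.v *)
From Stdlib Require Import Reals.
From Coquelicot Require Import Coquelicot.

Open Scope R_scope.

Definition unit_disk (z : C) : Prop := Cmod z < 1.

(* Functions on the disk are represented by total functions [C -> C]; only
   their values on [unit_disk] are ever used. *)
Definition analytic_on_disk (f : C -> C) : Prop :=
  forall z : C, unit_disk z -> ex_derive (K := C_AbsRing) f z.

Definition maclaurin (f : C -> C) (a : nat -> C) : Prop :=
  forall z : C, unit_disk z -> is_pseries (K := C_AbsRing) a z (f z).

(* The inner product is linear in its first argument. Positivity and
   definiteness follow from [inner_norm] and the axioms of [norm]. *)
Record HilbertSpace := {
  hilbert_carrier :> CompleteNormedModule C_AbsRing;
  inner : hilbert_carrier -> hilbert_carrier -> C;
  inner_plus_l : forall x y z : hilbert_carrier,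
    inner (plus x y) z = (inner x z + inner y z)%C;
  inner_scal_l : forall (k : C) (x y : hilbert_carrier),
    inner (scal k x) y = (k * inner x y)%C;
  inner_conj : forall x y : hilbert_carrier, inner y x = Cconj (inner x y);
  inner_norm : forall x : hilbert_carrier, inner x x = RtoC (norm x ^ 2)
}.

Arguments inner {h} x y.

Section Operators.

Context {E : HilbertSpace}.

Definition bounded_operator (A : E -> E) : Prop := is_linear A.

Definition is_adjoint (A B : E -> E) : Prop :=
  bounded_operator B /\ forall x y : E, inner (A x) y = inner x (B y).

Definition positive_operator (T : E -> E) : Prop :=
  forall x : E, Im (inner (T x) x) = 0 /\ 0 <= Re (inner (T x) x).

Definition operator_le (S T : E -> E) : Prop :=
  positive_operator (fun x => minus (T x) (S x)).

(* The adjoint, which exists by the Riesz theorem and is unique, is bound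
   existentially. *)
Definition hyponormal (A : E -> E) : Prop :=
  bounded_operator A /\
  exists B : E -> E, is_adjoint A B /\
    operator_le (fun x => A (B x)) (fun x => B (A x)).

Definition cohyponormal (A : E -> E) : Prop :=
  bounded_operator A /\
  exists B : E -> E, is_adjoint A B /\ hyponormal B.

End Operators.

(* The vectors are the functions [fn f] restricted to the disk.
   [whs_maclaurin] adds nothing to [whs_analytic] mathematically (it is Taylor's
   theorem); it guarantees that [whs_inner] speaks about all vectors. *)
Record WeightedHardySpace := {
  whs_hilbert :> HilbertSpace;
  fn : whs_hilbert -> C -> C;
  monomial : nat -> whs_hilbert;
  whs_plus : forall (f g : whs_hilbert) (z : C), unit_disk z ->
    fn (plus f g) z = (fn f z + fn g z)%C;
  whs_scal : forall (k : C) (f : whs_hilbert) (z : C), unit_disk z ->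
    fn (scal k f) z = (k * fn f z)%C;
  whs_inj : forall f g : whs_hilbert,
    (forall z : C, unit_disk z -> fn f z = fn g z) -> f = g;
  whs_analytic : forall f : whs_hilbert, analytic_on_disk (fn f);
  whs_maclaurin : forall f : whs_hilbert, exists a : nat -> C,
    maclaurin (fn f) a;
  whs_monomial : forall (n : nat) (z : C), unit_disk z ->
    fn (monomial n) z = (z ^ n)%C;
  whs_orthogonal : forall m n : nat, m <> n ->
    inner (monomial m) (monomial n) = RtoC 0;
  whs_nonzero : forall n : nat, monomial n <> zero;
  whs_dense : forall (f : whs_hilbert) (eps : R), 0 < eps ->
    exists (n : nat) (c : nat -> C),
      norm (minus f (sum_n (fun k => scal (c k) (monomial k)) n)) < eps;
  whs_normalized : norm (monomial 0) = 1;
  whs_inner : forall (f g : whs_hilbert) (a c : nat -> C),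
    maclaurin (fn f) a -> maclaurin (fn g) c ->
    is_series (fun j => a j * Cconj (c j) * RtoC (norm (monomial j) ^ 2))%C
      (inner f g)
}.

Arguments fn {w} f z.
Arguments monomial {w} n.

Definition weight (H : WeightedHardySpace) (n : nat) : R :=
  norm (monomial (w := H) n).

(* [A], acting on the vectors of [H], is the operator [T] given on functions;
   in particular [T] maps the functions of [H] to functions of [H]. *)
Definition acts_as (H : WeightedHardySpace) (T : (C -> C) -> C -> C)
    (A : H -> H) : Prop :=
  forall (f : H) (z : C), unit_disk z -> fn (A f) z = T (fn f) z.

Definition bounded_on (H : WeightedHardySpace) (T : (C -> C) -> C -> C) : Prop :=
  exists A : H -> H, acts_as H T A /\ bounded_operator A.

Definition cohyponormal_on (H : WeightedHardySpace)
    (T : (C -> C) -> C -> C) : Prop :=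
  exists A : H -> H, acts_as H T A /\ cohyponormal A.

Definition multiplication (psi : C -> C) (f : C -> C) (z : C) : C :=
  (psi z * f z)%C.

Definition weighted_composition (psi phi : C -> C) (f : C -> C) (z : C) : C :=
  (psi z * f (phi z))%C.

Definition univalent (f : C -> C) : Prop :=
  forall z w : C, unit_disk z -> unit_disk w -> f z = f w -> z = w.

(* Main.v *)
Require Import Defs.
From Stdlib Require Import Reals Arith Lra Lia Classical IndefiniteDescription.
From Coquelicot Require Import Coquelicot.
Open Scope R_scope.

(** Let [A] be the weighted composition operator. Its adjoint [A*] acts simply on
    reproducing kernels: [A* k_w = conj (psi w) * k_(phi w)], because
    [<A f, k_w> = (A f)(w) = psi w * f (phi w)]. Cohyponormality says
    [|A x| <= |A* x|], so the null space of [A*] is contained in that of [A]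
    ([ker_adjoint_cohyponormal]). On the other hand [A] is injective, since
    [psi] is not identically zero and [phi] is not constant
    ([weighted_composition_injective]). Hence [A*] is injective too.

    If [psi w = 0], then [A* k_w = 0], so [k_w = 0]; but [<1, k_w> = 1].
    If [phi z = phi w], then [A*] annihilates
    [conj (psi w) * k_z - conj (psi z) * k_w]; pairing this zero vector with the
    constant [1] gives [psi w = psi z], and pairing it with the identity function
    then gives [z = w].

    Two facts carry the argument. The first is that point evaluations are
    bounded, that is, that kernels exist ([reproducing_kernel]). It amounts to the
    convergence of the series of [(|w| ^ j / weight j) ^ 2]; the Abel-Dini theorem
    turns a divergent series of this kind into a vector of the space whose
    Maclaurin series diverges at [|w|].

    The second is the identity theorem for functions given by their Maclaurin
    series ([identity_theorem]), proved by dividing repeatedly by [z - p] at an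
    accumulation point [p] of zeros. With coefficients bounded by [M / r ^ n],
    each division multiplies [M] by [1 / (r - |p|)] while it extracts a factor
    [z - p]; so the function vanishes on the disk of radius [r - |p|] about [p],
    and by repetition on a chain of disks that leads to the origin. *)

(** * Complex series and power series *)

Lemma pow_n_C (z : C) (n : nat) : pow_n (K := C_Ring) z n = (z ^ n)%C.
Proof.
  induction n as [|n IH]; [reflexivity|].
  simpl. rewrite IH. reflexivity.
Qed.

Lemma is_pseries_C (a : nat -> C) (z l : C) :
  is_pseries (K := C_AbsRing) a z l <->
  is_series (K := C_AbsRing) (fun n => a n * z ^ n)%C l.
Proof.
  assert (E : forall n, scal (pow_n (K := C_Ring) z n) (a n) = (a n * z ^ n)%C).
  { intro n. rewrite pow_n_C. apply Cmult_comm. }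
  split; apply is_series_ext; intro n; [|symmetry]; apply E.
Qed.

Lemma is_series_eq {K : AbsRing} {V : NormedModule K} (x : nat -> V) (l m : V) :
  is_series x l -> is_series x m -> l = m.
Proof. apply filterlim_locally_unique. Qed.

Lemma is_series_cons (x : nat -> C) (l : C) :
  is_series (K := C_AbsRing) (fun n => x (S n)) l ->
  is_series (K := C_AbsRing) x (x 0%nat + l)%C.
Proof.
  intro H. apply is_series_decr_1.
  replace (plus _ _) with l; [exact H|].
  change (l = x 0%nat + l + - x 0%nat)%C. ring.
Qed.

Lemma norm_series_le {K : AbsRing} {V : NormedModule K} (x : nat -> V)
    (b : nat -> R) (l : V) (s : R) :
  is_series x l -> is_series b s -> (forall n, norm (x n) <= b n) ->
  norm l <= s.
Proof.
  intros Hx Hb Hle.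
  refine (filterlim_le (F := eventually) (fun n => norm (sum_n x n)) (sum_n b)
    (norm l) s _ _ Hb).
  - exists 0%nat. intros n _.
    apply Rle_trans with (1 := norm_sum_n_m x 0 n).
    apply sum_n_m_le. exact Hle.
  - refine (filterlim_comp _ _ _ (sum_n x) norm _ _ _ Hx _).
    apply filterlim_norm.
Qed.

Lemma bounded_terms (x : nat -> C) (l : C) :
  is_series (K := C_AbsRing) x l -> exists M, forall n, Cmod (x n) <= M.
Proof.
  intros Hx.
  destruct (filterlim_bounded (sum_n x)) as [M HM]; [now exists l|].
  exists (2 * M). intros [|n].
  - specialize (HM 0%nat). rewrite sum_O in HM.
    change (Cmod (x 0%nat) <= M) in HM. pose proof (Cmod_ge_0 (x 0%nat)). lra.
  - assert (E : x (S n) = (sum_n x (S n) - sum_n x n)%C).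
    { rewrite sum_Sn. change plus with Cplus. ring. }
    rewrite E.
    apply Rle_trans with (1 := Cmod_triangle _ _). rewrite Cmod_opp.
    pose proof (HM (S n)) as H1. pose proof (HM n) as H2.
    change (Cmod (sum_n x (S n)) <= M) in H1. change (Cmod (sum_n x n) <= M) in H2.
    lra.
Qed.

(** Cauchy's estimate on the circle of radius [r], as a property of coefficient
    sequences. It is stable under division by [z - p] with an explicit loss
    ([synthetic_division]), so that it can replace bounds on values. *)
Definition cauchy_bound (a : nat -> C) (r M : R) : Prop :=
  forall n, Cmod (a n) <= M / r ^ n.

Lemma geom_dominated (x : nat -> C) (c q : R) :
  0 <= q < 1 -> (forall n, Cmod (x n) <= c * q ^ n) ->
  exists l, is_series (K := C_AbsRing) x l /\ Cmod l <= c / (1 - q).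
Proof.
  intros Hq Hx.
  assert (Hg : is_series (fun n => c * q ^ n) (c / (1 - q))).
  { apply (is_series_scal c (fun n => q ^ n)). apply is_series_geom.
    rewrite Rabs_right; lra. }
  destruct (ex_series_le (V := C_CompleteNormedModule) x _ Hx) as [l Hl].
  { eexists; exact Hg. }
  exists l. split; [exact Hl|].
  exact (norm_series_le (V := C_NormedModule) _ _ _ _ Hl Hg Hx).
Qed.

(** Tails are treated along with the series itself, because they are the
    coefficients of the quotient by [z - p]. *)
Lemma cauchy_bound_tail (a : nat -> C) (r M : R) (z : C) (n : nat) :
  Cmod z < r -> cauchy_bound a r M ->
  exists l, is_series (K := C_AbsRing) (fun k => a (n + k)%nat * z ^ k)%C l /\
    Cmod l <= M / r ^ n / (1 - Cmod z / r).
Proof.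
  intros Hz Ha. pose proof (Cmod_ge_0 z) as H0.
  assert (Hr : 0 < r) by lra.
  apply geom_dominated.
  - split; [apply Rdiv_le_0_compat; lra|].
    apply (Rmult_lt_reg_r r); [lra|]. field_simplify; lra.
  - intro k. rewrite Cmod_mult, Cmod_pow.
    apply Rle_trans with (M / r ^ (n + k) * Cmod z ^ k).
    { apply Rmult_le_compat_r; [now apply pow_le|apply Ha]. }
    right. unfold Rdiv. rewrite Rpow_mult_distr, pow_add, pow_inv.
    assert (r ^ n <> 0) by (apply pow_nonzero; lra).
    assert (r ^ k <> 0) by (apply pow_nonzero; lra).
    now field.
Qed.

(** Horner's scheme for a series: the coefficients
    [q n = a (n+1) + a (n+2) * p + a (n+3) * p ^ 2 + ...] are those of
    [(a(z) - a(p)) / (z - p)]. The geometric series bounds them, at the cost of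
    a factor [1 / (r - |p|)]; that factor is what makes iterated division
    informative on a whole disk. *)
Lemma synthetic_division (a : nat -> C) (r M : R) (p : C) :
  Cmod p < r -> cauchy_bound a r M ->
  exists (q : nat -> C) (ap : C), cauchy_bound q r (M / (r - Cmod p)) /\
    ap = (a 0%nat + p * q 0%nat)%C /\
    (forall n, q n = a (S n) + p * q (S n))%C /\
    forall z l : C, Cmod z < r ->
      is_pseries (K := C_AbsRing) a z l ->
      exists l' : C, is_pseries (K := C_AbsRing) q z l' /\
        (l - ap = (z - p) * l')%C.
Proof.
  intros Hp Ha. pose proof (Cmod_ge_0 p) as H0.
  assert (Hr : 0 < r) by lra.
  (* t n is the tail of the series at p from index n on, divided by p ^ n:
     these tails are the quotient coefficients, shifted by one. *)
  destruct (functional_choice (fun n l =>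
    is_series (K := C_AbsRing) (fun k => a (n + k)%nat * p ^ k)%C l /\
    Cmod l <= M / r ^ n / (1 - Cmod p / r))) as [t Ht].
  { intro n. now apply cauchy_bound_tail. }
  assert (Hrec : forall n, (t n = a n + p * t (S n))%C).
  { intro n. apply (is_series_eq (V := C_NormedModule) _ _ _ (proj1 (Ht n))).
    replace (a n + p * t (S n))%C with
      (a (n + 0)%nat * p ^ 0 + p * t (S n))%C
      by (rewrite Nat.add_0_r; simpl; ring).
    apply (is_series_cons (fun k => a (n + k)%nat * p ^ k)%C).
    generalize (is_series_scal (K := C_AbsRing) (V := C_NormedModule)
      p _ _ (proj1 (Ht (S n)))).
    apply is_series_ext. intro k.
    change (p * (a (S n + k)%nat * p ^ k) = a (n + S k)%nat * p ^ S k)%C.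
    replace (n + S k)%nat with (S n + k)%nat by lia. rewrite Cpow_S. ring. }
  assert (Hq : cauchy_bound (fun n => t (S n)) r (M / (r - Cmod p))).
  { intro n. apply Rle_trans with (1 := proj2 (Ht (S n))). right. simpl.
    assert (r ^ n <> 0) by (apply pow_nonzero; lra).
    field. repeat split; lra. }
  exists (fun n => t (S n)), (t 0%nat). repeat split.
  - exact Hq.
  - apply Hrec.
  - intro n. apply Hrec.
  - intros z l Hz Hl. apply is_pseries_C in Hl.
    destruct (cauchy_bound_tail _ _ _ z 0 Hz Hq) as [l' [Hl' _]].
    exists l'. split; [now apply is_pseries_C|].
    assert (H1 : is_series (K := C_AbsRing) (fun k => t k * z ^ k)%C
      (l + p * l')%C).
    { generalize (is_series_plus (K := C_AbsRing) _ _ _ _ Hl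
        (is_series_scal (K := C_AbsRing) (V := C_NormedModule) p _ _ Hl')).
      apply is_series_ext. intro k.
      change (a k * z ^ k + p * (t (S k) * z ^ k) = t k * z ^ k)%C.
      rewrite (Hrec k). ring. }
    assert (H2 : is_series (K := C_AbsRing) (fun k => t k * z ^ k)%C
      (t 0%nat * z ^ 0 + z * l')%C).
    { apply (is_series_cons (fun k => t k * z ^ k)%C).
      generalize (is_series_scal (K := C_AbsRing) (V := C_NormedModule)
        z _ _ Hl').
      apply is_series_ext. intro k.
      change (z * (t (S k) * z ^ k) = t (S k) * z ^ S k)%C.
      rewrite Cpow_S. ring. }
    (* Compare two ways of summing t k * z ^ k: by the recurrence for t (H1), and
       by splitting off the term k = 0 (H2). *)
    pose proof (is_series_eq (V := C_NormedModule) _ _ _ H1 H2) as E.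
    simpl in E.
    replace l with (l + p * l' - p * l')%C by ring. rewrite E. ring.
Qed.

(** * The identity theorem *)

Definition zeros_cluster (a : nat -> C) (p : C) : Prop :=
  forall eps, 0 < eps -> exists u, 0 < Cmod (u - p) < eps /\
    is_pseries (K := C_AbsRing) a u (RtoC 0).

Lemma pseries_bound (a : nat -> C) (r M : R) (z l : C) :
  Cmod z < r -> cauchy_bound a r M -> is_pseries (K := C_AbsRing) a z l ->
  Cmod l <= M / (1 - Cmod z / r).
Proof.
  intros Hz Ha Hl.
  destruct (cauchy_bound_tail a r M z 0 Hz Ha) as [m [Hm Hb]].
  apply is_pseries_C in Hl.
  rewrite (is_series_eq (V := C_NormedModule) _ _ _ Hl Hm).
  simpl in Hb. now rewrite Rdiv_1_r in Hb.
Qed.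

Lemma cauchy_bound_nonneg (a : nat -> C) (r M : R) : cauchy_bound a r M -> 0 <= M.
Proof.
  intro Ha. specialize (Ha 0%nat). simpl in Ha.
  pose proof (Cmod_ge_0 (a 0%nat)). lra.
Qed.

Lemma Cmod_small_eq0 (z : C) (c d : R) :
  0 < d -> 0 <= c -> (forall eps, 0 < eps < d -> Cmod z <= eps * c) -> z = RtoC 0.
Proof.
  intros Hd Hc H. apply Cmod_eq_0.
  destruct (Rle_lt_or_eq_dec _ _ (Cmod_ge_0 z)) as [Hz|Hz]; [|now symmetry].
  set (e := Rmin (d / 2) (Cmod z / (2 * (c + 1)))).
  assert (He : 0 < e).
  { apply Rmin_glb_lt; [lra|]. apply Rdiv_lt_0_compat; lra. }
  assert (e < d) by (pose proof (Rmin_l (d / 2) (Cmod z / (2 * (c + 1)))); unfold e; lra).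
  specialize (H e (conj He H0)).
  assert (e * (c + 1) <= Cmod z / 2).
  { replace (Cmod z / 2) with (Cmod z / (2 * (c + 1)) * (c + 1)) by (field; lra).
    apply Rmult_le_compat_r; [lra|]. apply Rmin_r. }
  lra.
Qed.

(** The value [a(p)] equals [(p - u) * q(u)] at every zero [u], where [q(u)] stays
    bounded as [u] tends to [p]; hence [a(p) = 0]. Then [a(z) = (z - p) * q(z)], so
    [q] vanishes at the same points [u] and inherits the accumulation: the
    division can be iterated. *)
Lemma divide_cluster_zero (a : nat -> C) (r M : R) (p : C) :
  Cmod p < r -> cauchy_bound a r M -> zeros_cluster a p ->
  exists q, cauchy_bound q r (M / (r - Cmod p)) /\ zeros_cluster q p /\
    a 0%nat = (- p * q 0%nat)%C /\
    (forall n, q n = a (S n) + p * q (S n))%C /\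
    forall z l : C, Cmod z < r -> is_pseries (K := C_AbsRing) a z l ->
      exists l' : C, is_pseries (K := C_AbsRing) q z l' /\ l = ((z - p) * l')%C.
Proof.
  intros Hp Ha Hz. pose proof (Cmod_ge_0 p) as H0.
  destruct (synthetic_division a r M p Hp Ha) as [q [ap [Hq [Eap [Hrec Hdiv]]]]].
  assert (Hnear : forall u eps, Cmod (u - p) < eps -> eps <= (r - Cmod p) / 2 ->
    Cmod u <= (r + Cmod p) / 2).
  { intros u eps Hu He. replace u with (u - p + p)%C by ring.
    pose proof (Cmod_triangle (u - p) p). lra. }
  pose proof (cauchy_bound_nonneg _ _ _ Hq) as HM'.
  set (M' := M / (r - Cmod p)) in *.
  assert (E : ap = RtoC 0).
  { apply (Cmod_small_eq0 ap (M' / (1 - (r + Cmod p) / 2 / r)) ((r - Cmod p) / 2));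
      [lra| |].
    - apply Rdiv_le_0_compat; [lra|].
      apply (Rmult_lt_reg_r (2 * r)); [lra|]. field_simplify; lra.
    - intros eps He. destruct (Hz eps (proj1 He)) as [u [Hu Hau]].
      assert (Hur : Cmod u <= (r + Cmod p) / 2) by (apply (Hnear u eps); lra).
      destruct (Hdiv u _ ltac:(lra) Hau) as [l' [Hl' Ed]].
      replace ap with (- ((u - p) * l'))%C by (rewrite <- Ed; ring).
      rewrite Cmod_opp, Cmod_mult.
      apply Rmult_le_compat; try apply Cmod_ge_0; [lra|].
      apply Rle_trans with (1 := pseries_bound q r M' u l' ltac:(lra) Hq Hl').
      apply Rmult_le_compat_l; [lra|].
      apply Rinv_le_contravar.
      + apply (Rmult_lt_reg_r (2 * r)); [lra|]. field_simplify; lra.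
      + assert (Cmod u / r <= (r + Cmod p) / 2 / r); [|lra].
        apply Rmult_le_compat_r; [|lra].
        left. apply Rinv_0_lt_compat. lra. }
  exists q. rewrite E in *. repeat split; trivial.
  - intros eps He.
    destruct (Hz (Rmin eps ((r - Cmod p) / 2))) as [u [Hu Hau]].
    { apply Rmin_glb_lt; lra. }
    pose proof (Rmin_l eps ((r - Cmod p) / 2)).
    pose proof (Rmin_r eps ((r - Cmod p) / 2)).
    assert (Hur : Cmod u <= (r + Cmod p) / 2)
      by (apply (Hnear u _ (proj2 Hu)); lra).
    destruct (Hdiv u _ ltac:(lra) Hau) as [l' [Hl' Ed]].
    exists u. split; [lra|].
    replace (RtoC 0) with l'; [exact Hl'|].
    destruct (Ceq_dec l' 0) as [|Hn]; trivial. exfalso.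
    apply (Cmult_neq_0 (u - p) l'); [| |rewrite <- Ed; ring]; trivial.
    apply Cmod_gt_0. lra.
  - replace (a 0%nat) with (a 0%nat + p * q 0%nat - p * q 0%nat)%C by ring.
    rewrite <- Eap. ring.
  - intros z l Hzr Hl. destruct (Hdiv z l Hzr Hl) as [l' [Hl' Ed]].
    exists l'. split; [exact Hl'|]. rewrite <- Ed. ring.
Qed.

(** [N] divisions by [z - p] bring out a factor [(z - p) ^ N] and cost
    [1 / (r - |p|) ^ N]. *)
Lemma cluster_zero_order (p : C) (r : R) (N : nat) :
  Cmod p < r -> forall (a : nat -> C) (M : R),
  cauchy_bound a r M -> zeros_cluster a p ->
  forall z l : C, Cmod z < r -> is_pseries (K := C_AbsRing) a z l ->
  Cmod l <= (Cmod (z - p) / (r - Cmod p)) ^ N * (M / (1 - Cmod z / r)).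
Proof.
  intro Hp. induction N as [|N IH]; intros a M Ha Hacc z l Hz Hl.
  - simpl. rewrite Rmult_1_l. now apply (pseries_bound a).
  - destruct (divide_cluster_zero a r M p Hp Ha Hacc)
      as [q [Hq [Hqacc [_ [_ Hdiv]]]]].
    destruct (Hdiv z l Hz Hl) as [l' [Hl' ->]].
    specialize (IH q _ Hq Hqacc z l' Hz Hl').
    rewrite Cmod_mult.
    apply Rle_trans with (1 := Rmult_le_compat_l _ _ _ (Cmod_ge_0 _) IH).
    pose proof (Cmod_ge_0 p). pose proof (Cmod_ge_0 z).
    right. simpl. field. lra.
Qed.

(** Let the number of divisions tend to infinity in [cluster_zero_order]. *)
Lemma cluster_zero_ball (p : C) (r : R) (a : nat -> C) (M : R) (z l : C) :
  Cmod p < r -> cauchy_bound a r M -> zeros_cluster a p ->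
  Cmod (z - p) < r - Cmod p -> is_pseries (K := C_AbsRing) a z l ->
  l = RtoC 0.
Proof.
  intros Hp Ha Hacc Hz Hl. pose proof (Cmod_ge_0 p).
  assert (Hzr : Cmod z < r).
  { replace z with (z - p + p)%C by ring.
    pose proof (Cmod_triangle (z - p) p). lra. }
  pose proof (Cmod_ge_0 (z - p)).
  set (t := Cmod (z - p) / (r - Cmod p)).
  assert (Ht : 0 <= t < 1).
  { unfold t. split; [apply Rdiv_le_0_compat; lra|].
    apply (Rmult_lt_reg_r (r - Cmod p)); [lra|]. field_simplify; lra. }
  set (c := M / (1 - Cmod z / r)).
  assert (Hlim : is_lim_seq (fun N => t ^ N * c) 0).
  { replace (Finite 0) with (Rbar_mult 0 c) by (simpl; f_equal; ring).
    apply is_lim_seq_scal_r. apply is_lim_seq_geom. rewrite Rabs_right; lra. }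
  apply Cmod_eq_0. apply Rle_antisym; [|apply Cmod_ge_0].
  apply (is_lim_seq_le (fun _ => Cmod l) (fun N => t ^ N * c) (Cmod l) 0).
  - intro N. now apply (cluster_zero_order p r N Hp a M).
  - apply is_lim_seq_const.
  - exact Hlim.
Qed.

(** At the origin, division by [z - p] is the shift of the coefficients, and
    every shifted series again has value [0] there. *)
Lemma cluster_zero_origin (n : nat) : forall (a : nat -> C) (r M : R),
  0 < r -> cauchy_bound a r M -> zeros_cluster a (RtoC 0) -> a n = RtoC 0.
Proof.
  induction n as [|n IH]; intros a r M Hr Ha Hacc;
    destruct (divide_cluster_zero a r M (RtoC 0))
      as [q [Hq [Hqacc [Ea [Hrec _]]]]]; trivial; try (rewrite Cmod_0; lra).
  - rewrite Ea. ring.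
  - replace (a (S n)) with (q n) by (rewrite Hrec; ring).
    exact (IH q r _ Hr Hq Hqacc).
Qed.

Lemma maclaurin_cauchy_bound (f : C -> C) (a : nat -> C) (r : R) :
  maclaurin f a -> 0 < r < 1 -> exists M, cauchy_bound a r M.
Proof.
  intros Ha Hr.
  assert (Hd : unit_disk (RtoC r)).
  { unfold unit_disk. rewrite Cmod_R, Rabs_right; lra. }
  pose proof (proj1 (is_pseries_C _ _ _) (Ha _ Hd)) as Hs.
  destruct (bounded_terms _ _ Hs) as [M HM].
  exists M. intro n. specialize (HM n).
  rewrite Cmod_mult, Cmod_pow, Cmod_R, Rabs_right in HM by lra.
  assert (0 < r ^ n) by (apply pow_lt; lra).
  apply (Rmult_le_reg_r (r ^ n)); [lra|].
  replace (M / r ^ n * r ^ n) with M by (field; lra). exact HM.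
Qed.

(** With [r = (1 + |p|) / 2] the function vanishes on the disk of radius
    [(1 - |p|) / 2] about [p] ([cluster_zero_ball]), hence on a neighbourhood
    of [p']. *)
Lemma cluster_zero_step (f : C -> C) (a : nat -> C) (p p' : C) :
  maclaurin f a -> unit_disk p -> zeros_cluster a p ->
  2 * Cmod (p' - p) < 1 - Cmod p -> zeros_cluster a p'.
Proof.
  intros Ha Hp Hacc Hpp. unfold unit_disk in Hp. pose proof (Cmod_ge_0 p).
  set (r := (1 + Cmod p) / 2).
  destruct (maclaurin_cauchy_bound f a r Ha) as [M HM]; [unfold r; lra|].
  set (d := (1 - Cmod p) / 2 - Cmod (p' - p)).
  assert (Hd : 0 < d) by (unfold d; lra).
  intros eps He.
  set (h := Rmin (d / 2) (eps / 2)).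
  assert (Hh : 0 < h) by (unfold h; apply Rmin_glb_lt; lra).
  assert (Hu : Cmod (p' + RtoC h - p') = h).
  { replace (p' + RtoC h - p')%C with (RtoC h) by ring.
    rewrite Cmod_R, Rabs_right; lra. }
  assert (h <= d / 2) by apply Rmin_l. assert (h <= eps / 2) by apply Rmin_r.
  assert (Hup : Cmod (p' + RtoC h - p) < (1 - Cmod p) / 2).
  { replace (p' + RtoC h - p)%C with ((p' + RtoC h - p') + (p' - p))%C by ring.
    pose proof (Cmod_triangle (p' + RtoC h - p') (p' - p)). unfold d in *. lra. }
  exists (p' + RtoC h)%C. split; [lra|].
  assert (Hud : unit_disk (p' + RtoC h)%C).
  { unfold unit_disk. replace (p' + RtoC h)%C with (p' + RtoC h - p + p)%C by ring.
    pose proof (Cmod_triangle (p' + RtoC h - p) p). lra. }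
  pose proof (Ha _ Hud) as Hval.
  assert (E : f (p' + RtoC h)%C = RtoC 0).
  { apply (cluster_zero_ball p r a M (p' + RtoC h)); trivial; unfold r; lra. }
  rewrite E in Hval.
  exact Hval.
Qed.

(** Towards the origin the distance to the unit circle grows, so the step length
    [d] stays admissible along the whole radius and finitely many steps reach
    [0]. This is the usual connectedness argument, along one segment. *)
Lemma cluster_zero_walk (f : C -> C) (a : nat -> C) (d : R) (n : nat) :
  maclaurin f a -> 0 < d -> forall p, Cmod p <= INR n * d -> 2 * d < 1 - Cmod p ->
  zeros_cluster a p -> zeros_cluster a (RtoC 0).
Proof.
  intros Ha Hd. induction n as [|n IH]; intros p Hn Hp Hacc;
    pose proof (Cmod_ge_0 p) as H0.
  - simpl in Hn. replace (RtoC 0) with p; [exact Hacc|].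
    apply Cmod_eq_0. lra.
  - assert (Hdisk : unit_disk p) by (unfold unit_disk; lra).
    destruct (Rle_lt_dec (Cmod p) d) as [Hs|Hs].
    + apply (cluster_zero_step f a p); trivial.
      replace (0 - p)%C with (- p)%C by ring. rewrite Cmod_opp. lra.
    + set (s := 1 - d / Cmod p).
      assert (Hs' : s * Cmod p = Cmod p - d) by (unfold s; field; lra).
      assert (Hs0 : 0 < s).
      { apply (Rmult_lt_reg_r (Cmod p)); [lra|]. rewrite Hs'. lra. }
      assert (Hm : Cmod (RtoC s * p) = Cmod p - d).
      { rewrite Cmod_mult, Cmod_R, Rabs_right by lra. exact Hs'. }
      apply (IH (RtoC s * p)%C).
      * rewrite Hm. rewrite S_INR in Hn. lra.
      * rewrite Hm. lra.
      * apply (cluster_zero_step f a p); trivial.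
        replace (RtoC s * p - p)%C with (- (RtoC (d / Cmod p) * p))%C.
        2:{ unfold s. rewrite RtoC_minus. ring. }
        rewrite Cmod_opp, Cmod_mult, Cmod_R, Rabs_right.
        2:{ apply Rle_ge. apply Rdiv_le_0_compat; lra. }
        replace (d / Cmod p * Cmod p) with d by (field; lra). lra.
Qed.

(** The zeros accumulate at the origin as well, where the coefficients can be read
    off directly. *)
Theorem identity_theorem (f : C -> C) (a : nat -> C) (p : C) :
  maclaurin f a -> unit_disk p ->
  (forall eps, 0 < eps -> exists u, unit_disk u /\ 0 < Cmod (u - p) < eps /\
    f u = RtoC 0) ->
  forall z, unit_disk z -> f z = RtoC 0.
Proof.
  intros Ha Hp Hacc z Hz.
  assert (H0 : zeros_cluster a (RtoC 0)).
  { unfold unit_disk in Hp. pose proof (Cmod_ge_0 p).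
    set (d := (1 - Cmod p) / 4). assert (Hd : 0 < d) by (unfold d; lra).
    destruct (nfloor_ex (Cmod p / d)) as [n [_ Hn]].
    { apply Rdiv_le_0_compat; lra. }
    apply (cluster_zero_walk f a d (S n) Ha Hd p).
    - rewrite S_INR. apply (Rmult_lt_compat_r d) in Hn; [|exact Hd].
      replace (Cmod p / d * d) with (Cmod p) in Hn by (field; lra). lra.
    - unfold d. lra.
    - intros eps He. destruct (Hacc eps He) as [u [Hu [Hd1 Hfu]]].
      exists u. split; [exact Hd1|]. rewrite <- Hfu. now apply Ha. }
  destruct (maclaurin_cauchy_bound f a (1 / 2) Ha) as [M HM]; [lra|].
  pose proof (proj1 (is_pseries_C _ _ _) (Ha z Hz)) as Hfz.
  pose proof (is_series_scal (K := C_AbsRing) (V := C_NormedModule) (RtoC 0)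
    _ _ Hfz) as Hzero.
  replace (f z) with (RtoC 0 * f z)%C; [ring|].
  apply (is_series_eq (V := C_NormedModule) _ _ _ Hzero).
  refine (is_series_ext _ _ _ _ Hfz). intro n.
  rewrite (cluster_zero_origin n a (1 / 2) M ltac:(lra) HM H0).
  change (RtoC 0 * z ^ n = RtoC 0 * (RtoC 0 * z ^ n))%C. ring.
Qed.

(** * Hilbert spaces *)

Section InnerProduct.

Context {E : HilbertSpace}.
Implicit Types x y z : E.

Lemma inner_plus_r x y z : inner x (plus y z) = (inner x y + inner x z)%C.
Proof.
  rewrite inner_conj, inner_plus_l, (inner_conj _ y x), (inner_conj _ z x).
  rewrite (inner_conj _ x y), (inner_conj _ x z).
  rewrite Cplus_conj, !Cconj_conj. reflexivity.
Qed.

Lemma norm_plus_sqr x y :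
  norm (plus x y) ^ 2 = norm x ^ 2 + norm y ^ 2 + 2 * Re (inner x y).
Proof.
  pose proof (inner_norm _ (plus x y)) as H.
  rewrite inner_plus_l, !inner_plus_r, !inner_norm, (inner_conj _ x y) in H.
  apply (f_equal Re) in H. revert H.
  destruct (inner x y) as [u v]. simpl. lra.
Qed.

Lemma inner_eq0 x : inner x x = RtoC 0 -> x = zero.
Proof.
  rewrite inner_norm. intro H. apply RtoC_inj in H.
  apply (norm_eq_zero (V := CompleteNormedModule.NormedModule _ E)).
  apply Rsqr_0_uniq. unfold Rsqr. lra.
Qed.

Lemma Re_inner_le x y : Re (inner x y) <= norm x * norm y.
Proof.
  pose proof (norm_plus_sqr x y) as H.
  assert (norm (plus x y) ^ 2 <= (norm x + norm y) ^ 2); [|lra].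
  apply pow_incr. split; [apply norm_ge_0|]. apply (norm_triangle x y).
Qed.

(** Rotate [x] by a unimodular scalar that makes [inner x y] real and positive,
    and apply [Re_inner_le], which is the triangle inequality for [plus x y]
    squared. *)
Lemma cauchy_schwarz x y : Cmod (inner x y) <= norm x * norm y.
Proof.
  destruct (Ceq_dec (inner x y) 0) as [->|Hn].
  { rewrite Cmod_0. apply Rmult_le_pos; apply norm_ge_0. }
  pose proof (proj1 (Cmod_gt_0 _) Hn) as Hm.
  set (v := inner x y) in *.
  set (k := (Cconj v / RtoC (Cmod v))%C).
  assert (Hk : Cmod k = 1).
  { unfold k. rewrite Cmod_div, Cmod_conj, Cmod_R, Rabs_right; [field|..]; try lra.
    intro E0. apply RtoC_inj in E0. lra. }
  pose proof (Re_inner_le (scal k x) y) as H.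
  rewrite inner_scal_l in H. fold v in H.
  replace (k * v)%C with (RtoC (Cmod v)) in H.
  2:{ unfold k. replace (Cconj v / Cmod v * v)%C with (v * Cconj v / Cmod v)%C
        by (field; intro E0; apply RtoC_inj in E0; lra).
      rewrite <- Cmod2_conj. rewrite RtoC_pow. field.
      intro E0; apply RtoC_inj in E0; lra. }
  apply Rle_trans with (1 := H).
  apply Rmult_le_compat_r; [apply norm_ge_0|].
  pose proof (norm_scal k x) as Hs. change (abs k) with (Cmod k) in Hs.
  rewrite Hk, Rmult_1_l in Hs. exact Hs.
Qed.

Lemma is_linear_inner y : is_linear (K := C_AbsRing) (fun x => inner x y).
Proof.
  split.
  - intros u v. apply inner_plus_l.
  - intros k u. apply inner_scal_l.
  - exists (norm y + 1). pose proof (norm_ge_0 y). split; [lra|].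
    intro u. pose proof (norm_ge_0 u).
    apply Rle_trans with (1 := cauchy_schwarz u y).
    rewrite Rmult_comm. apply Rmult_le_compat_r; lra.
Qed.

Lemma inner_minus_l x y z : inner (minus x y) z = (inner x z - inner y z)%C.
Proof. exact (linear_minus _ x y (is_linear_inner z)). Qed.

Lemma inner_zero_l y : inner zero y = RtoC 0.
Proof. exact (linear_zero _ (is_linear_inner y)). Qed.

Lemma norm_sum_orthogonal_le (x : nat -> E) (b : nat -> R) (n m : nat) :
  (forall i j, i <> j -> inner (x i) (x j) = RtoC 0) ->
  (forall i, norm (x i) ^ 2 <= b i) ->
  norm (sum_n_m x n m) ^ 2 <= sum_n_m b n m.
Proof.
  intros Ho Hb.
  assert (Hz : forall k j, (k < j)%nat -> inner (sum_n_m x n k) (x j) = RtoC 0).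
  { intros k j. induction k as [|k IH]; intro Hk.
    - destruct (Nat.eq_dec n 0) as [->|Hn0].
      + rewrite sum_n_n. apply Ho. lia.
      + rewrite sum_n_m_zero by lia. apply inner_zero_l.
    - destruct (le_lt_dec n (S k)) as [Hle|Hlt].
      + rewrite sum_n_Sm, inner_plus_l, IH, Ho by lia. ring.
      + rewrite sum_n_m_zero by lia. apply inner_zero_l. }
  assert (H0 : norm (zero : E) ^ 2 <= 0).
  { pose proof (inner_norm _ (zero : E)) as H. rewrite inner_zero_l in H.
    apply RtoC_inj in H. lra. }
  induction m as [|m IH].
  - destruct (Nat.eq_dec n 0) as [->|Hn0].
    + rewrite !sum_n_n. apply Hb.
    + rewrite !sum_n_m_zero by lia. exact H0.
  - destruct (le_lt_dec n (S m)) as [Hle|Hlt].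
    + rewrite !sum_n_Sm by lia. rewrite norm_plus_sqr, Hz by lia.
      specialize (Hb (S m)). change plus with Rplus. simpl Re. lra.
    + rewrite !sum_n_m_zero by lia. exact H0.
Qed.

Lemma orthogonal_series (x : nat -> E) (b : nat -> R) :
  (forall i j, i <> j -> inner (x i) (x j) = RtoC 0) ->
  (forall i, norm (x i) ^ 2 <= b i) -> ex_series b ->
  exists l : E, is_series x l.
Proof.
  intros Ho Hb Hs.
  apply (ex_series_Cauchy (V := hilbert_carrier E)).
  intros eps.
  destruct (Cauchy_ex_series (V := R_CompleteNormedModule) b Hs
    (mkposreal (eps ^ 2) ltac:(apply pow_lt, cond_pos))) as [N HN].
  exists N. intros n m Hn Hm.
  specialize (HN n m Hn Hm). simpl in HN.
  pose proof (norm_sum_orthogonal_le x b n m Ho Hb) as H.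
  pose proof (cond_pos eps).
  apply Rsqr_incrst_0; [|apply norm_ge_0|lra].
  unfold Rsqr. simpl in H. rewrite Rmult_1_r in H. rewrite Rmult_1_r in HN.
  eapply Rle_lt_trans; [exact H|].
  eapply Rle_lt_trans; [apply Rle_abs|exact HN].
Qed.

End InnerProduct.

Lemma is_series_linear {K : AbsRing} {U V : NormedModule K} (L : U -> V)
    (x : nat -> U) (l : U) :
  is_linear L -> is_series x l -> is_series (fun n => L (x n)) (L l).
Proof.
  intros HL Hx.
  apply (filterlim_ext (fun n => L (sum_n x n))).
  - induction x0 as [|n IH]; [now rewrite !sum_O|].
    now rewrite !sum_Sn, (linear_plus L HL), IH.
  - refine (filterlim_comp _ _ _ (sum_n x) L _ _ _ Hx _).
    exact (linear_cont L l HL).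
Qed.

(** Write [B] for the adjoint of [A]. Hyponormality of [B] gives
    [norm (A x) <= norm (B x)]. *)
Lemma ker_adjoint_cohyponormal {E : HilbertSpace} (A : E -> E) :
  cohyponormal A -> exists B : E -> E, is_adjoint A B /\
    forall x, B x = zero -> A x = zero.
Proof.
  intros [_ [B [HAB [HB [B' [HBB' Hle]]]]]].
  exists B. split; [exact HAB|]. intros x Hx.
  (* The adjoint B' of B is A: adjoints are unique. *)
  assert (EA : A x = B' x).
  { assert (H : forall y, inner (minus (A x) (B' x)) y = RtoC 0).
    { intro y. rewrite inner_minus_l, (proj2 HAB).
      rewrite (inner_conj _ (B y) x), (proj2 HBB'), <- inner_conj. ring. }
    specialize (H (minus (A x) (B' x))). apply inner_eq0 in H.
    apply plus_reg_r with (opp (B' x)). now rewrite plus_opp_r. }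
  rewrite EA. destruct (Hle x) as [_ Hre].
  assert (E0 : inner (B' (B x)) x = RtoC 0).
  { rewrite Hx.
    transitivity (inner (zero : E) x); [|exact (inner_zero_l x)].
    f_equal. exact (linear_zero B' (proj1 HBB')). }
  rewrite inner_minus_l, E0 in Hre.
  rewrite (proj2 HBB'), inner_norm in Hre. simpl in Hre.
  apply (norm_eq_zero (V := CompleteNormedModule.NormedModule _ E)).
  apply Rsqr_0_uniq. unfold Rsqr.
  apply Rle_antisym; [lra|]. apply Rle_0_sqr.
Qed.

(** * The Abel-Dini theorem *)

Lemma ex_series_bounded (b : nat -> R) (M : R) :
  (forall n, 0 <= b n) -> (forall n, sum_n b n <= M) -> ex_series b.
Proof.
  intros Hb HM.
  destruct (ex_finite_lim_seq_incr (sum_n b) M) as [l Hl]; trivial.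
  - intro n. rewrite sum_Sn. specialize (Hb (S n)). change plus with Rplus. lra.
  - now exists l.
Qed.

Section AbelDini.

Context (t : nat -> R) (t_pos : forall n, 0 <= t n) (t0_pos : 0 < t 0%nat).

Let s n := sum_n t n.

Lemma partial_sum_S n : s (S n) = s n + t (S n).
Proof. unfold s. now rewrite sum_Sn. Qed.

Lemma partial_sum_pos n : 0 < s n.
Proof.
  induction n as [|n IH]; [unfold s; now rewrite sum_O|].
  rewrite partial_sum_S. specialize (t_pos (S n)). lra.
Qed.

Lemma partial_sum_le n k : s n <= s (n + k).
Proof.
  induction k as [|k IH]; [rewrite Nat.add_0_r; lra|].
  rewrite Nat.add_succ_r, partial_sum_S. specialize (t_pos (S (n + k))). lra.
Qed.

(** Telescoping: [t (n+1) / s (n+1) ^ 2 <= 1 / s n - 1 / s (n+1)]. *)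
Lemma abel_dini_convergent : ex_series (fun n => t n / s n ^ 2).
Proof.
  apply (ex_series_bounded _ (2 / t 0%nat)).
  - intro n. pose proof (partial_sum_pos n).
    apply Rdiv_le_0_compat; [apply t_pos|]. now apply pow_lt.
  - assert (H : forall n, sum_n (fun n => t n / s n ^ 2) n <= 2 / t 0%nat - / s n).
    { induction n as [|n IH].
      - rewrite sum_O. unfold s. rewrite sum_O. right. field. lra.
      - rewrite sum_Sn. change plus with Rplus.
        pose proof (partial_sum_pos n). pose proof (partial_sum_pos (S n)).
        assert (t (S n) / s (S n) ^ 2 <= / s n - / s (S n)); [|lra].
        replace (t (S n)) with (s (S n) - s n) by (rewrite partial_sum_S; ring).
        assert (Hle : s n <= s (S n)).
        { rewrite partial_sum_S. specialize (t_pos (S n)). lra. }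
        replace (/ s n - / s (S n)) with ((s (S n) - s n) / (s n * s (S n)))
          by (field; lra).
        apply Rmult_le_compat_l; [lra|].
        apply Rinv_le_contravar; [now apply Rmult_lt_0_compat|].
        simpl. rewrite Rmult_1_r. apply Rmult_le_compat_r; lra. }
    intro n. specialize (H n). pose proof (Rinv_0_lt_compat _ (partial_sum_pos n)).
    lra.
Qed.

(** A block of the series from [N+1] to [m] is at least [(s m - s N) / s m], so
    Cauchy's criterion with tolerance [1/2] bounds [s m] by [2 * s N]. *)
Lemma abel_dini_divergent : ex_series (fun n => t n / s n) -> ex_series t.
Proof.
  intro Hex.
  destruct (Cauchy_ex_series (V := R_CompleteNormedModule) _ Hex
    (mkposreal (1 / 2) ltac:(lra))) as [N HN].
  apply (ex_series_bounded t (2 * s N)); [exact t_pos|].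
  assert (Htail : forall k, (s (N + k)%nat - s N) / s (N + k)%nat <=
    sum_n_m (fun n => t n / s n) (S N) (N + k)).
  { intro k.
    assert (H : forall j, (j <= k)%nat -> (s (N + j)%nat - s N) / s (N + k)%nat <=
      sum_n_m (fun n => t n / s n) (S N) (N + j)).
    { induction j as [|j IH]; intro Hj.
      - rewrite Nat.add_0_r, sum_n_m_zero by lia.
        right. change zero with 0. unfold Rdiv. ring.
      - rewrite Nat.add_succ_r, sum_n_Sm by lia. change plus with Rplus.
        replace (s (S (N + j)) - s N) with (s (N + j)%nat + t (S (N + j)) - s N)
          by (rewrite partial_sum_S; ring).
        replace ((s (N + j)%nat + t (S (N + j)) - s N) / s (N + k)%nat) with
          ((s (N + j)%nat - s N) / s (N + k)%nat + t (S (N + j)) / s (N + k)%nat)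
          by (unfold Rdiv; ring).
        apply Rplus_le_compat; [apply IH; lia|].
        apply Rmult_le_compat_l; [apply t_pos|].
        apply Rinv_le_contravar; [apply partial_sum_pos|].
        replace (N + k)%nat with (S (N + j) + (k - S j))%nat by lia.
        apply partial_sum_le. }
    now apply H. }
  intro n. change (s n <= 2 * s N).
  assert (Hn : s n <= s (N + n)%nat) by (rewrite Nat.add_comm; apply partial_sum_le).
  specialize (Htail n).
  pose proof (partial_sum_pos N) as HsN. pose proof (partial_sum_pos (N + n)) as HsM.
  destruct (Nat.eq_dec n 0) as [->|Hn0]; [rewrite Nat.add_0_r in *; lra|].
  specialize (HN (S N) (N + n)%nat ltac:(lia) ltac:(lia)). simpl in HN.
  apply Rle_lt_trans with (1 := Rle_abs _) in HN.
  assert (Hlt : (s (N + n)%nat - s N) / s (N + n)%nat < 1 / 2)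
    by (eapply Rle_lt_trans; [exact Htail|exact HN]).
  apply (Rmult_lt_compat_r (s (N + n)%nat)) in Hlt; [|exact HsM].
  replace ((s (N + n)%nat - s N) / s (N + n)%nat * s (N + n)%nat)
    with (s (N + n)%nat - s N) in Hlt by (field; lra).
  lra.
Qed.

End AbelDini.

(** * Weighted Hardy spaces *)

Lemma is_series_single (j : nat) : forall (x : nat -> C),
  (forall k, k <> j -> x k = RtoC 0) -> is_series (K := C_AbsRing) x (x j).
Proof.
  assert (H0 : is_series (K := C_AbsRing) (fun _ => RtoC 0) (RtoC 0)).
  { apply (filterlim_ext (fun _ => RtoC 0)); [|apply filterlim_const].
    intro n. symmetry. exact (sum_n_m_const_zero (G := C_AbelianMonoid) 0 n). }
  induction j as [|j IH]; intros x Hx.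
  - replace (x 0%nat) with (x 0%nat + 0)%C by ring.
    apply is_series_cons.
    apply (is_series_ext (fun _ => RtoC 0)); [|exact H0].
    intro n. symmetry. now apply Hx.
  - replace (x (S j)) with (x 0%nat + x (S j))%C by (rewrite (Hx 0%nat); [ring|lia]).
    apply is_series_cons.
    apply (IH (fun n => x (S n))). intros k Hk. apply Hx. lia.
Qed.

Lemma is_series_Re (x : nat -> C) (l : C) :
  is_series (K := C_AbsRing) x l -> is_series (fun n => Re (x n)) (Re l).
Proof.
  intro Hx.
  apply (filterlim_ext (fun n => Re (sum_n x n))).
  - intro n. induction n as [|n IH]; [now rewrite !sum_O|].
    rewrite !sum_Sn, <- IH. reflexivity.
  - refine (filterlim_comp _ _ _ (sum_n x) Re _ _ _ Hx _).
    destruct l as [u v].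
    exact (continuous_fst (U := R_UniformSpace) (V := R_UniformSpace) u v).
Qed.

Lemma analytic_continuous (g : C -> C) (p : C) (eps : R) :
  analytic_on_disk g -> unit_disk p -> 0 < eps ->
  exists d, 0 < d /\ forall u, Cmod (u - p) < d -> Cmod (g u - g p) < eps.
Proof.
  intros Hg Hp He.
  pose proof (ex_derive_continuous (K := C_AbsRing) (V := C_NormedModule) g p
    (Hg p Hp)) as Hc.
  destruct (proj1 (filterlim_locally_ball_norm (U := C_NormedModule) g (g p)) Hc
    (mkposreal eps He)) as [d Hd].
  exists d. split; [apply cond_pos|]. intros u Hu. exact (Hd u Hu).
Qed.

Section HardySpace.

Context {H : WeightedHardySpace}.

Lemma maclaurin_monomial (j : nat) :
  maclaurin (fn (w := H) (monomial j))
    (fun k => if Nat.eq_dec k j then RtoC 1 else RtoC 0).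
Proof.
  intros z Hz. rewrite whs_monomial by exact Hz. apply is_pseries_C.
  set (x := fun k => ((if Nat.eq_dec k j then RtoC 1 else RtoC 0) * z ^ k)%C).
  replace (z ^ j)%C with (x j).
  - apply is_series_single. intros k Hk. unfold x.
    destruct (Nat.eq_dec k j); [contradiction|ring].
  - unfold x. destruct (Nat.eq_dec j j); [ring|contradiction].
Qed.

Lemma inner_monomial (f : H) (a : nat -> C) (j : nat) :
  maclaurin (fn f) a ->
  inner f (monomial j) = (a j * RtoC (weight H j ^ 2))%C.
Proof.
  intro Ha.
  pose proof (whs_inner H f (monomial j) a _ Ha (maclaurin_monomial j)) as Hs.
  apply (is_series_eq (V := C_NormedModule) _ _ _ Hs).
  set (x := fun k => (a k * Cconj (if Nat.eq_dec k j then RtoC 1 else RtoC 0) *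
    RtoC (norm (monomial (w := H) k) ^ 2))%C).
  assert (E1 : Cconj (RtoC 1) = RtoC 1) by (unfold Cconj, RtoC; simpl; f_equal; ring).
  assert (E0 : Cconj (RtoC 0) = RtoC 0) by (unfold Cconj, RtoC; simpl; f_equal; ring).
  replace (a j * RtoC (weight H j ^ 2))%C with (x j).
  - apply (is_series_single j x). intros k Hk. unfold x.
    destruct (Nat.eq_dec k j); [contradiction|]. rewrite E0. ring.
  - unfold x, weight. destruct (Nat.eq_dec j j); [|contradiction].
    rewrite E1. ring.
Qed.

Lemma weight_pos (j : nat) : 0 < weight H j.
Proof.
  destruct (norm_ge_0 (monomial (w := H) j)) as [Hp|E]; [exact Hp|].
  exfalso. apply (whs_nonzero H j).
  apply (norm_eq_zero (V := CompleteNormedModule.NormedModule _ H)).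
  symmetry. exact E.
Qed.

(** The partial sums form a Cauchy sequence by orthogonality, and [H] is
    complete. *)
Lemma riesz_fischer (c : nat -> C) :
  ex_series (fun j => (Cmod (c j) * weight H j) ^ 2) ->
  exists f : H, is_series (fun j => scal (c j) (monomial (w := H) j)) f.
Proof.
  intro Hc.
  apply (orthogonal_series _ (fun j => (Cmod (c j) * weight H j) ^ 2)); trivial.
  - intros i j Hij. rewrite inner_scal_l, inner_conj, inner_scal_l.
    rewrite whs_orthogonal by (now apply not_eq_sym).
    unfold Cconj, RtoC, Cmult. simpl. f_equal; ring.
  - intro i. apply pow_incr. split; [apply norm_ge_0|].
    apply (norm_scal (c i) (monomial (w := H) i)).
Qed.

Lemma inner_series_monomial (c : nat -> C) (f : H) (j : nat) :
  is_series (fun k => scal (c k) (monomial (w := H) k)) f ->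
  inner f (monomial j) = (c j * RtoC (weight H j ^ 2))%C.
Proof.
  intro Hf.
  set (x := fun k => inner (scal (c k) (monomial (w := H) k)) (monomial j)).
  assert (Hx : is_series (K := C_AbsRing) x (inner f (monomial j)))
    by exact (is_series_linear _ _ _ (is_linear_inner (monomial j)) Hf).
  replace (c j * RtoC (weight H j ^ 2))%C with (x j).
  - apply (is_series_eq (V := C_NormedModule) _ _ _ Hx).
    apply is_series_single. intros k Hk. unfold x.
    rewrite inner_scal_l, whs_orthogonal by exact Hk. ring.
  - unfold x. now rewrite inner_scal_l, inner_norm.
Qed.

(** The inner product with [monomial n] is continuous and reads off the [n]-th
    coefficient, whence the norm limit of the polynomials has the expected
    Maclaurin series. *)
Lemma maclaurin_series (c : nat -> C) (f : H) :
  is_series (fun k => scal (c k) (monomial (w := H) k)) f -> maclaurin (fn f) c.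
Proof.
  intro Hf. destruct (whs_maclaurin H f) as [a Ha].
  intros z Hz. apply is_pseries_C.
  apply (is_series_ext (fun n => a n * z ^ n)%C);
    [|apply is_pseries_C; now apply Ha].
  intro n. apply (f_equal (fun u => u * z ^ n)%C).
  assert (Hw : RtoC (weight H n ^ 2) <> RtoC 0).
  { intro E0. apply RtoC_inj in E0. pose proof (pow_lt _ 2 (weight_pos n)). lra. }
  assert (E : (a n * RtoC (weight H n ^ 2) = c n * RtoC (weight H n ^ 2))%C).
  { rewrite <- (inner_monomial f a n Ha). now apply inner_series_monomial. }
  replace (a n) with (a n * RtoC (weight H n ^ 2) / RtoC (weight H n ^ 2))%C
    by (field; exact Hw).
  rewrite E. now field.
Qed.

(** This is the boundedness of the evaluations, and it follows from the
    convergence of Maclaurin series on the disk. Let [t j] be the general term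
    and [s j] its partial sums. The sequence [c j = r ^ j / (weight j ^ 2 * s j)] satisfies
    [(c j * weight j) ^ 2 = t j / s j ^ 2], which is summable by Abel-Dini, so [c]
    is the Maclaurin sequence of a vector of [H]. The series of this vector
    converges at [r], where its terms are [t j / s j]; by Abel-Dini again, [t] is
    summable. *)
Lemma kernel_coefficients_summable (r : R) : 0 <= r < 1 ->
  ex_series (fun j => (r ^ j / weight H j) ^ 2).
Proof.
  intro Hr.
  set (t := fun j => (r ^ j / weight H j) ^ 2).
  assert (Ht : forall n, 0 <= t n) by (intro n; apply pow2_ge_0).
  assert (Ht0 : 0 < t 0%nat).
  { apply pow_lt. apply Rdiv_lt_0_compat; [simpl; lra|apply weight_pos]. }
  apply (abel_dini_divergent t Ht Ht0).
  assert (Hs : forall n, 0 < sum_n t n) by (exact (partial_sum_pos t Ht Ht0)).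
  set (c := fun j => r ^ j / (weight H j ^ 2 * sum_n t j)).
  assert (Hc0 : forall j, 0 <= c j).
  { intro j. apply Rdiv_le_0_compat; [apply pow_le; lra|].
    apply Rmult_lt_0_compat; [apply pow_lt, weight_pos|apply Hs]. }
  destruct (riesz_fischer (fun j => RtoC (c j))) as [f Hf].
  { apply (ex_series_ext (fun n => t n / sum_n t n ^ 2)).
    2: now apply abel_dini_convergent.
    intro j. pose proof (weight_pos j). pose proof (Hs j).
    change (t j / sum_n t j ^ 2 = (Cmod (RtoC (c j)) * weight H j) ^ 2).
    rewrite Cmod_R, Rabs_right by (apply Rle_ge, Hc0).
    unfold t at 1, c. field. lra. }
  assert (Hd : unit_disk (RtoC r)).
  { unfold unit_disk. rewrite Cmod_R, Rabs_right; lra. }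
  pose proof (maclaurin_series _ _ Hf _ Hd) as Hser.
  apply is_pseries_C, is_series_Re in Hser.
  eexists. refine (is_series_ext _ _ _ _ Hser). intro n.
  rewrite <- RtoC_pow, <- RtoC_mult.
  pose proof (weight_pos n). pose proof (Hs n).
  change (c n * r ^ n = t n / sum_n t n).
  unfold c. unfold t at 2. field. lra.
Qed.

(** The kernel at [w] has the coefficients [conj (w ^ j) / weight j ^ 2]; they
    are square-summable against the weights by [kernel_coefficients_summable]. *)
Theorem reproducing_kernel (w : C) : unit_disk w ->
  exists k : H, forall f : H, inner f k = fn f w.
Proof.
  intro Hw.
  set (c := fun j => (Cconj (w ^ j) / RtoC (weight H j ^ 2))%C).
  assert (Hc2 : forall j, RtoC (weight H j ^ 2) <> RtoC 0).
  { intros j E0. apply RtoC_inj in E0. pose proof (pow_lt _ 2 (weight_pos j)). lra. }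
  destruct (riesz_fischer c) as [k Hk].
  { apply (ex_series_ext (fun j => (Cmod w ^ j / weight H j) ^ 2)).
    2: now apply kernel_coefficients_summable; split; [apply Cmod_ge_0|].
    intro j. pose proof (weight_pos j).
    change ((Cmod w ^ j / weight H j) ^ 2 = (Cmod (c j) * weight H j) ^ 2).
    unfold c. rewrite Cmod_div, Cmod_conj, Cmod_pow, Cmod_R by apply Hc2.
    rewrite Rabs_right by (apply Rle_ge, pow2_ge_0). field. lra. }
  exists k. intro f. destruct (whs_maclaurin H f) as [a Ha].
  pose proof (whs_inner H f k a c Ha (maclaurin_series c k Hk)) as Hs.
  apply (is_series_eq (V := C_NormedModule) _ _ _ Hs).
  refine (is_series_ext _ _ _ _ (proj1 (is_pseries_C _ _ _) (Ha w Hw))).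
  intro j.
  change (a j * w ^ j = a j * Cconj (c j) * RtoC (weight H j ^ 2))%C.
  unfold c. rewrite Cdiv_conj, Cconj_conj by apply Hc2.
  replace (Cconj (RtoC (weight H j ^ 2))) with (RtoC (weight H j ^ 2)).
  - field. apply Hc2.
  - unfold Cconj, RtoC. simpl. f_equal. ring.
Qed.

Lemma vanishes_near (f : H) (p : C) (d : R) :
  unit_disk p -> 0 < d ->
  (forall u, unit_disk u -> Cmod (u - p) < d -> fn f u = RtoC 0) ->
  forall z, unit_disk z -> fn f z = RtoC 0.
Proof.
  intros Hp Hd Hf. destruct (whs_maclaurin H f) as [a Ha].
  apply (identity_theorem (fn f) a p Ha Hp). intros eps He.
  unfold unit_disk in Hp.
  set (h := Rmin (Rmin d eps) (1 - Cmod p) / 2).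
  assert (Hm : 0 < Rmin (Rmin d eps) (1 - Cmod p))
    by (repeat apply Rmin_glb_lt; lra).
  pose proof (Rmin_l (Rmin d eps) (1 - Cmod p)).
  pose proof (Rmin_r (Rmin d eps) (1 - Cmod p)).
  pose proof (Rmin_l d eps). pose proof (Rmin_r d eps).
  assert (Eh : Cmod (p + RtoC h - p) = h).
  { replace (p + RtoC h - p)%C with (RtoC h) by ring.
    rewrite Cmod_R, Rabs_right; unfold h; lra. }
  assert (Hu : unit_disk (p + RtoC h)%C).
  { unfold unit_disk. replace (p + RtoC h)%C with (p + (p + RtoC h - p))%C by ring.
    pose proof (Cmod_triangle p (p + RtoC h - p)). unfold h in *. lra. }
  exists (p + RtoC h)%C. split; [exact Hu|]. rewrite Eh. split; [unfold h; lra|].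
  apply Hf; [exact Hu|]. rewrite Eh. unfold h. lra.
Qed.

Lemma analytic_neq_near (g : C -> C) (p c : C) :
  analytic_on_disk g -> unit_disk p -> g p <> c ->
  exists d, 0 < d /\ forall u, Cmod (u - p) < d -> g u <> c.
Proof.
  intros Hg Hp Hc.
  assert (Hpos : 0 < Cmod (g p - c)).
  { apply Cmod_gt_0. intro E. apply Hc.
    replace (g p) with (g p - c + c)%C by ring. rewrite E. ring. }
  destruct (analytic_continuous g p _ Hg Hp Hpos) as [d [Hd Hu]].
  exists d. split; [exact Hd|]. intros u Hud E. specialize (Hu u Hud).
  rewrite E in Hu. replace (c - g p)%C with (- (g p - c))%C in Hu by ring.
  rewrite Cmod_opp in Hu. lra.
Qed.

Lemma fn_zero (z : C) : unit_disk z -> fn (w := H) zero z = RtoC 0.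
Proof.
  intro Hz.
  assert (E : plus (zero : H) zero = zero) by apply (plus_zero_r (G := H)).
  pose proof (whs_plus H zero zero z Hz) as Hp. rewrite E in Hp.
  replace (fn (w := H) zero z) with
    (fn (w := H) zero z + fn (w := H) zero z - fn (w := H) zero z)%C at 1 by ring.
  rewrite <- Hp. ring.
Qed.

(** * Injectivity of weighted composition operators *)

Section WeightedComposition.

Context (psi phi : C -> C) (A : H -> H).
Context (psi_analytic : analytic_on_disk psi)
  (psi_nonzero : exists z, unit_disk z /\ psi z <> RtoC 0)
  (phi_disk : forall z, unit_disk z -> unit_disk (phi z))
  (phi_analytic : analytic_on_disk phi)
  (phi_nonconstant : exists z w, unit_disk z /\ unit_disk w /\ phi z <> phi w)
  (A_acts : acts_as H (weighted_composition psi phi) A).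

(** [identity_theorem] asks for a Maclaurin series, and [phi] is only known to be
    differentiable. However [psi], the image of [1], and [psi * phi], the image of
    the identity function, are in [H]. If [phi] were constant near [p], then
    [psi * (phi - phi p)] would vanish near [p], hence everywhere; [psi] would then vanish near any point [q]
    with [phi q <> phi p], hence everywhere, against [psi p <> 0]. *)
Lemma phi_nonconstant_near (p : C) (d : R) :
  unit_disk p -> psi p <> RtoC 0 -> 0 < d ->
  exists z, unit_disk z /\ Cmod (z - p) < d /\ phi z <> phi p.
Proof.
  intros Hp Hpsi Hd. apply NNPP. intro Hno.
  set (g := plus (A (monomial 1)) (scal (- phi p)%C (A (monomial 0)))).
  assert (Hg : forall z, unit_disk z -> fn g z = (psi z * (phi z - phi p))%C).
  { intros z Hz. unfold g. rewrite whs_plus, whs_scal, !A_acts by exact Hz.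
    unfold weighted_composition. rewrite !whs_monomial by (now apply phi_disk).
    simpl. ring. }
  assert (Hg0 : forall z, unit_disk z -> fn g z = RtoC 0).
  { apply (vanishes_near g p d Hp Hd). intros u Hu Hup.
    rewrite Hg by exact Hu.
    destruct (Ceq_dec (phi u) (phi p)) as [->|Hn]; [ring|].
    exfalso. apply Hno. now exists u. }
  assert (Hex : exists q, unit_disk q /\ phi q <> phi p).
  { destruct phi_nonconstant as [z [w [Hz [Hw Hzw]]]].
    destruct (Ceq_dec (phi z) (phi p)) as [E|E]; [|now exists z].
    exists w. split; [exact Hw|]. now rewrite <- E; apply not_eq_sym. }
  destruct Hex as [q [Hq Hqp]].
  destruct (analytic_neq_near phi q (phi p) phi_analytic Hq Hqp) as [e [He Hne]].
  apply Hpsi.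
  assert (Epsi : forall z, unit_disk z -> fn (A (monomial 0)) z = psi z).
  { intros z Hz. rewrite A_acts by exact Hz. unfold weighted_composition.
    rewrite whs_monomial by (now apply phi_disk). simpl. ring. }
  rewrite <- Epsi by exact Hp.
  apply (vanishes_near _ q e Hq He); [|exact Hp].
  intros u Hu Huq. rewrite Epsi by exact Hu. apply NNPP. intro Hn.
  apply (Cmult_neq_0 (psi u) (phi u - phi p)); [exact Hn| |].
  - intro E. apply (Hne u Huq).
    replace (phi u) with (phi u - phi p + phi p)%C by ring. rewrite E. ring.
  - rewrite <- Hg by exact Hu. now apply Hg0.
Qed.

(** If [psi * (f o phi) = 0], then [f] vanishes on the image under [phi] of a
    neighbourhood of a point [p] where [psi] does not vanish. By
    [phi_nonconstant_near] this image accumulates at [phi p]. *)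
Lemma weighted_composition_injective (f : H) : A f = zero -> f = zero.
Proof.
  intro HA. apply whs_inj. intros z Hz. rewrite fn_zero by exact Hz.
  revert z Hz.
  destruct psi_nonzero as [p [Hp Hpsi]].
  destruct (whs_maclaurin H f) as [a Ha].
  apply (identity_theorem (fn f) a (phi p) Ha (phi_disk p Hp)).
  intros eps He.
  destruct (analytic_continuous phi p eps phi_analytic Hp He) as [d1 [Hd1 Hphi]].
  destruct (analytic_neq_near psi p 0 psi_analytic Hp Hpsi) as [d2 [Hd2 Hpsin]].
  destruct (phi_nonconstant_near p (Rmin d1 d2) Hp Hpsi) as [z [Hz [Hzp Hne]]].
  { now apply Rmin_glb_lt. }
  pose proof (Rmin_l d1 d2). pose proof (Rmin_r d1 d2).
  exists (phi z). repeat split.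
  - now apply phi_disk.
  - apply Cmod_gt_0. intro E. apply Hne.
    replace (phi z) with (phi z - phi p + phi p)%C by ring. rewrite E. ring.
  - apply Hphi. lra.
  - apply NNPP. intro Hn.
    apply (Cmult_neq_0 (psi z) (fn f (phi z))); [apply Hpsin; lra|exact Hn|].
    change (weighted_composition psi phi (fn f) z = RtoC 0).
    rewrite <- A_acts by exact Hz. rewrite HA. now apply fn_zero.
Qed.

End WeightedComposition.

End HardySpace.

(** * Cohyponormal weighted composition operators *)

Theorem corollary2p4 (H : WeightedHardySpace) (psi phi : C -> C)
    (hbeta : exists M : R, forall j : nat, weight H (S j) / weight H j <= M)
    (psi_analytic : analytic_on_disk psi)
    (psi_nonzero : exists z : C, unit_disk z /\ psi z <> RtoC 0)
    (psi_multiplier : bounded_on H (multiplication psi))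
    (phi_disk : forall z : C, unit_disk z -> unit_disk (phi z))
    (phi_analytic : analytic_on_disk phi)
    (phi_nonconstant : exists z w : C,
        unit_disk z /\ unit_disk w /\ phi z <> phi w)
    (hcohypo : cohyponormal_on H (weighted_composition psi phi)) :
  (forall z : C, unit_disk z -> psi z <> RtoC 0) /\ univalent phi.
Proof.
  destruct hcohypo as [A [HA Hco]].
  destruct (ker_adjoint_cohyponormal A Hco) as [B [[_ HB] Hker]].
  assert (Hzero : forall x : H, (forall f, inner (A f) x = RtoC 0) -> x = zero).
  { intros x Hx. apply (weighted_composition_injective psi phi A); trivial.
    apply Hker. apply inner_eq0. rewrite <- HB. apply Hx. }
  (* If psi w = 0, the kernel at w is orthogonal to the range of A. *)
  assert (Hpsi : forall z, unit_disk z -> psi z <> RtoC 0).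
  { intros w Hw E. destruct (reproducing_kernel (H := H) w Hw) as [k Hk].
    assert (Ek : k = zero).
    { apply Hzero. intro f. rewrite Hk, HA by exact Hw.
      unfold weighted_composition. rewrite E. ring. }
    pose proof (Hk (monomial 0)) as H1.
    rewrite whs_monomial in H1 by exact Hw.
    rewrite inner_conj, Ek, inner_zero_l in H1.
    simpl in H1. apply (f_equal Re) in H1. simpl in H1. lra. }
  split; [exact Hpsi|].
  intros z w Hz Hw E.
  destruct (reproducing_kernel (H := H) z Hz) as [kz Hkz].
  destruct (reproducing_kernel (H := H) w Hw) as [kw Hkw].
  (* The adjoint of A sends the kernel at z to conj (psi z) times the kernel at
     phi z; x is the combination of two kernels whose images cancel. *)
  pose (x := (plus (scal (Cconj (psi w)) kz) (scal (- Cconj (psi z))%C kw)) : H).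
  assert (Hx : forall f : H, inner f x = (psi w * fn f z - psi z * fn f w)%C).
  { intro f.
    transitivity (inner f (scal (Cconj (psi w)) kz) +
      inner f (scal (- Cconj (psi z))%C kw))%C; [exact (inner_plus_r f _ _)|].
    rewrite !(inner_conj _ (scal _ _) f), !inner_scal_l.
    rewrite !Cmult_conj, <- !inner_conj, Hkz, Hkw, Copp_conj, !Cconj_conj. ring. }
  assert (Ex : x = zero).
  { apply Hzero. intro f. rewrite Hx, !HA by assumption.
    unfold weighted_composition. rewrite E. ring. }
  assert (H0 : forall f : H, (psi w * fn f z - psi z * fn f w = RtoC 0)%C).
  { intro f. rewrite <- Hx, Ex, inner_conj.
    replace (inner zero f) with (RtoC 0) by (symmetry; exact (inner_zero_l f)).
    unfold Cconj, RtoC. simpl. f_equal. ring. }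
  (* Testing against 1 gives psi w = psi z; against the identity, z = w. *)
  pose proof (H0 (monomial 0)) as E0. pose proof (H0 (monomial 1)) as E1.
  rewrite !whs_monomial in E0, E1 by assumption. simpl in E0, E1.
  apply NNPP. intro Hn.
  apply (Cmult_neq_0 (psi w) (z - w)); [now apply Hpsi| |].
  - intro Ezw. apply Hn. replace z with (z - w + w)%C by ring. rewrite Ezw. ring.
  - replace (psi w * (z - w))%C with
      (psi w * (z * 1) - psi z * (w * 1) - w * (psi w * 1 - psi z * 1))%C by ring.
    rewrite E0, E1. ring.
Qed.
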